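(* Let $H$ be a graph with $n$ vertices, $m$ edges and maximum degree at most $3$, and let $(A,+)$ be a finite abelian group. Then for every integer $f$ with $$f\ge 7m|A|+4n\,\sigma(A)+14|A|,$$ every $A$-weighted $K_f$-minor contains an $A$-divisible $H$-subdivision (as a subgraph).
   Context: Graphs are finite and simple. A $K_f$-minor is a graph $G$ whose vertex set is partitioned into $f$ disjoint non-empty sets $X_1,\dots,X_f$ such that for every $i$ the induced subgraph $G[X_i]$ is connected, and for all $i\ne j$ there is at least one edge of $G$ with endpoints in $X_i$ and $X_j$. An $A$-weighted $K_f$-minor is a $K_f$-minor $G$ equipped with a map $w:E(G)\to A$ (edge weights). A subdivision of $H$ is any graph obtained from $H$ by replacing its edges with internally vertex-disjoint paths connecting the original endpoints of the edges; these paths are called subdivision paths. A subdivision of $H$ contained as a subgraph in an $A$-weighted graph is an $A$-divisible $H$-subdivision if, for every subdivision path, the sum in $A$ of the weights of its edges equals $0\in A$. For a finite abelian group $A$, $$\sigma(A)=\max_{B\le A}\frac{|\{a\in A: 2a\in B\}|}{|B|},$$ where the maximum is over all subgroups $B$ of $A$. *)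

(* Defs.v *)
From HB Require Import structures.
From mathcomp Require Import all_boot all_order all_algebra all_fingroup.
Set Implicit Arguments.
Unset Strict Implicit.
Unset Printing Implicit Defensive.
Import GRing.Theory.

Record sgraph := SGraph {
  vertex :> finType;
  adj : rel vertex;
  adj_sym : symmetric adj;
  adj_irrefl : irreflexive adj
}.

Definition edges (G : sgraph) : {set {set G}} :=
  [set [set xy.1; xy.2] | xy : G * G & adj xy.1 xy.2].

Definition degree (G : sgraph) (x : G) : nat := #|[set y | adj x y]|.

Definition max_degree (G : sgraph) : nat := \max_(x : G) degree x.

Definition induced_connected (G : sgraph) (X : {set G}) : Prop :=
  forall x y, x \in X -> y \in X ->
    connect [rel u v : G | [&& u \in X, v \in X & adj u v]] x y.

Definition clique_minor (f : nat) (G : sgraph) : Prop :=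
  exists X : 'I_f -> {set G},
  [/\ forall i, X i != set0,
      forall i j, i != j -> [disjoint X i & X j],
      \bigcup_(i < f) X i = [set: G],
      forall i, induced_connected (X i)
    & forall i j, i != j -> exists x y, [/\ x \in X i, y \in X j & adj x y]].

(* The edges traversed by the walk [x :: p]. *)
Definition walk_edges (T : finType) (x : T) (p : seq T) : seq {set T} :=
  pairmap (fun a b => [set a; b]) x p.

(* For an edge [uv] of [H], [P u v] lists the internal vertices of the
   subdivision path from [phi u] to [phi v], and [sub_tail phi P u v] is that
   path with its first vertex [phi u] removed.  The two orientations of an edge
   give the same path, reversed. *)
Definition sub_tail (H S : sgraph) (phi : H -> S) (P : H -> H -> seq S)
    (u v : H) : seq S := rcons (P u v) (phi v).

Record subdivision (H S : sgraph) (phi : H -> S) (P : H -> H -> seq S) : Prop :=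
  Subdivision {
  sub_branch_inj : injective phi;
  sub_rev : forall u v, adj u v -> P v u = rev (P u v);
  sub_path : forall u v, adj u v -> path (@adj S) (phi u) (sub_tail phi P u v);
  sub_uniq : forall u v, adj u v -> uniq (phi u :: sub_tail phi P u v);
  sub_branch_internal : forall u v x, adj u v -> phi x \notin P u v;
  sub_internal_disjoint : forall u v u' v', adj u v -> adj u' v' ->
    [set u; v] != [set u'; v'] -> [disjoint P u v & P u' v'];
  (* [S] has no vertices or edges besides those of the subdivision paths and
     the branch vertices. *)
  sub_vertices : forall s : S, (exists x, s = phi x) \/
    (exists u v, adj u v /\ s \in P u v);
  sub_edges : forall e, e \in edges S ->
    exists u v, adj u v /\ e \in walk_edges (phi u) (sub_tail phi P u v)
}.

Definition subgraph_embedding (S G : sgraph) (iota : S -> G) : Prop :=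
  injective iota /\ {homo iota : x y / adj x y}.

(* Edge weights of [G] are given by a function on all sets of vertices, of which
   only the values on [edges G] are ever used. *)
Definition divisible_subdivision (A : finZmodType) (H G : sgraph)
    (w : {set G} -> A) : Prop :=
  exists (S : sgraph) (phi : H -> S) (P : H -> H -> seq S) (iota : S -> G),
  [/\ subdivision phi P, subgraph_embedding iota
    & forall u v, adj u v ->
        (\sum_(e <- walk_edges (phi u) (sub_tail phi P u v)) w (iota @: e) = 0)%R].

Definition halving (A : finZmodType) (B : {group A}) : {set A} :=
  [set a : A | (a *+ 2)%R \in B].

(* The division below is exact, see [dvdn_halving]. *)
Definition sigma (A : finZmodType) : nat :=
  \max_(B : {group A}) (#|halving B| %/ #|B|).

Lemma dvdn_halving (A : finZmodType) (B : {group A}) : #|B| %| #|halving B|.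
Proof.
have gH : group_set (halving B).
  apply/group_setP; split; first by rewrite inE mul0rn (group1 B).
  move=> x y; rewrite !inE => hx hy; rewrite FinRing.zmodMgE mulrnDl.
  by rewrite -FinRing.zmodMgE groupM.
apply: (@cardSg _ (Group gH) B); apply/subsetP => x xB.
by rewrite inE mulr2n -FinRing.zmodMgE groupM.
Qed.

(* Main.v *)
(* Two vertices in different bags are joined by paths that run through any
   prescribed sequence of distinct bags in between. A gadget is a run L-X-Y-R
   of bags in which the part inside X and Y can be replaced by a path that may
   also use a further bag Z; its shift is the resulting change of weight. A
   chain of gadgets gives a path whose possible weights are the subset sums of
   the shifts, up to a constant, and this set grows with each gadget whose
   shift lies outside its stabilizer. Hence, for each edge of H, fewer than |B|
   gadgets suffice either to realize the whole current group B by subset sums,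
   or to reach a proper subgroup C of B such that the minor left over is rigid
   modulo C: all its gadgets have their shift in C. In the second case we retry
   with C, which is at most half as large.

   In a minor that is rigid modulo B, deleting an inner bag from a sequence of
   bags does not change the weight modulo B. Take a claw inside four bags, a
   centre bag and three legs. Comparing the three ways of crossing it shows that
   paths between the centres x and y of two claws have weight phi(y) - phi(x)
   modulo B whatever legs they use; reversal of the paths gives
   2 (phi(y) - phi(x)) in B. By pigeonhole, among n sigma(A) claws there are n
   with phi constant modulo B. They are the branch vertices, and the chain of
   each edge corrects the weight of its path, which is 0 modulo the group
   realized by the chain. *)
Require Import Defs.
From mathcomp Require Import all_boot all_order all_algebra all_fingroup zify.
From Stdlib Require Import Classical.

Set Implicit Arguments.
Unset Strict Implicit.
Unset Printing Implicit Defensive.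
Import GRing.Theory.
Local Open Scope ring_scope.

(** * Congruence modulo a subgroup of [A] *)

Section ModuloSubgroup.
Variables (A : finZmodType).
Implicit Types (B : {group A}) (a b c : A).

Definition congr_mod B a b := a - b \in B.

Lemma zgroup0 B : 0 \in B. Proof. exact: (group1 B). Qed.

Lemma zgroupD B a b : a \in B -> b \in B -> a + b \in B.
Proof. by rewrite -FinRing.zmodMgE; apply: groupM. Qed.

Lemma zgroupN B a : a \in B -> - a \in B.
Proof. by rewrite -FinRing.zmodVgE groupV. Qed.

Lemma congr_mod_sym B a b : congr_mod B a b -> congr_mod B b a.
Proof. by rewrite /congr_mod -[b - a]opprB; apply: zgroupN. Qed.

Lemma congr_mod_trans B b a c :
  congr_mod B a b -> congr_mod B b c -> congr_mod B a c.
Proof.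
by rewrite /congr_mod => ab bc; rewrite -(subrKA b); apply: zgroupD.
Qed.

Lemma congr_modD B a b a' b' :
  congr_mod B a b -> congr_mod B a' b' -> congr_mod B (a + a') (b + b').
Proof. by rewrite /congr_mod opprD addrACA; apply: zgroupD. Qed.

Lemma congr_modN B a b : congr_mod B a b -> congr_mod B (- a) (- b).
Proof. by rewrite /congr_mod -opprD; apply: zgroupN. Qed.

Lemma congr_modDr B c a b : congr_mod B (a + c) (b + c) = congr_mod B a b.
Proof. by rewrite /congr_mod opprD addrACA subrr addr0. Qed.

Lemma congr_modDl B c a b : congr_mod B (c + a) (c + b) = congr_mod B a b.
Proof. by rewrite ![c + _]addrC congr_modDr. Qed.

End ModuloSubgroup.

(** * Weights of walks and of their reversals *)

Section PathWeight.
Variables (G : sgraph) (A : finZmodType) (w : {set G} -> A).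
Implicit Types (x y z : G) (p q : seq G).

Definition path_weight x p : A := \sum_(e <- walk_edges x p) w e.

Local Notation pw := path_weight.

Lemma pw_cons x y p : pw x (y :: p) = w [set x; y] + pw y p.
Proof. exact: big_cons. Qed.

Lemma pw_cat x p q : pw x (p ++ q) = pw x p + pw (last x p) q.
Proof. by rewrite /path_weight /walk_edges pairmap_cat big_cat. Qed.

Lemma walk_edges_rev x p :
  walk_edges (last x p) (rev (belast x p)) = rev (walk_edges x p).
Proof.
elim: p x => //= y p IHp x; rewrite rev_cons /walk_edges -cats1 pairmap_cat.
rewrite -/(walk_edges _ _) IHp rev_cons -cats1; congr (_ ++ _) => /=.
congr [:: _]; rewrite setUC; congr (_ |: _); congr [set _].
by case: p {IHp} => //= z p; rewrite rev_cons last_rcons.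
Qed.

Lemma pw_rev x p : pw (last x p) (rev (belast x p)) = pw x p.
Proof. by rewrite /path_weight walk_edges_rev big_rev. Qed.

End PathWeight.

(** * Paths through prescribed sequences of bags *)

Section Routes.
Variables (G : sgraph) (I : finType) (bag : G -> I).
Implicit Types (x y z : G) (p q : seq G) (i j : I) (s t : seq I).

Definition spath s x p y :=
  [&& path (@adj G) x p, last x p == y, uniq (x :: p)
    & all (fun z => bag z \in s) (x :: p)].

Lemma spath_last s x p y : spath s x p y -> last x p = y.
Proof. by case/and4P=> _ /eqP. Qed.

Lemma spath_mem s x p y z : spath s x p y -> z \in x :: p -> bag z \in s.
Proof. by case/and4P=> _ _ _ /allP; apply. Qed.

Lemma spath_sub s t x p y : {subset s <= t} -> spath s x p y -> spath t x p y.
Proof.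
move=> st /and4P[xp yp up /allP sp]; apply/and4P; split=> //.
by apply/allP=> z /sp /st.
Qed.

Lemma rev_belast x p : rev (x :: p) = last x p :: rev (belast x p).
Proof. by rewrite lastI rev_rcons. Qed.

Lemma spath_rev s x p y : spath s x p y -> spath s y (rev (belast x p)) x.
Proof.
case/and4P=> xp /eqP <- up sp; apply/and4P; split.
- by rewrite rev_path (@eq_path _ _ (@adj G)) // => u v; rewrite adj_sym.
- by case: p {xp up sp} => //= z p; rewrite rev_cons last_rcons.
- by rewrite -rev_belast rev_uniq.
- by rewrite -rev_belast all_rev.
Qed.

(** No bag occurs in both [s] and [t], so the two pieces cannot share a vertex. *)
Lemma spath_cat s t x p y x' q y' :
  spath s x p y -> adj y x' -> spath t x' q y' -> ~~ has (mem s) t ->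
  spath (s ++ t) x (p ++ x' :: q) y'.
Proof.
move=> /and4P[xp /eqP yp up sp] yx' /and4P[xq /eqP yq uq sq] /hasPn st.
apply/and4P; split.
- by rewrite cat_path xp /= yp yx'.
- by rewrite last_cat /= yq.
- rewrite -cat_cons cat_uniq up uq andbT; apply/hasPn=> z zq.
  apply: contraL (st _ (allP sq _ zq)) => zp; rewrite negbK.
  exact: (allP sp _ zp).
- rewrite -cat_cons all_cat; apply/andP; split; apply/allP=> z.
    by move/(allP sp); rewrite mem_cat => ->.
  by move/(allP sq); rewrite mem_cat orbC => ->.
Qed.

(* Unlike [spath s], [route s] visits every bag of [s], in this order, each in
   one contiguous run. *)
Inductive route : seq I -> G -> seq G -> G -> Prop :=
| route_one i x p y : spath [:: i] x p y -> route [:: i] x p y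
| route_cons i s x p y x' q y' :
    spath [:: i] x p y -> i \notin s -> adj y x' -> route s x' q y' ->
    route (i :: s) x (p ++ x' :: q) y'.

Lemma route_spath s x p y : route s x p y -> spath s x p y.
Proof.
elim=> // {s x p y} i s x p y x' q y' xp iNs yx' _ IH.
rewrite -cat1s; apply: spath_cat xp yx' IH _.
by apply/hasPn=> j js; apply: contraNN iNs; rewrite /= mem_seq1 => /eqP <-.
Qed.

Lemma route_uniq s x p y : route s x p y -> uniq s.
Proof. by elim=> //= {s x p y} *; apply/andP. Qed.

Lemma spath1_bag i x p y : spath [:: i] x p y -> bag x = i /\ bag y = i.
Proof.
move=> xp; rewrite -(spath_last xp).
have := spath_mem xp (mem_head x p); have := spath_mem xp (mem_last x p).
by rewrite !inE => /eqP -> /eqP ->.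
Qed.

Lemma route_bag i s x p y : route (i :: s) x p y -> bag x = i /\ bag y = last i s.
Proof.
move=> r; split.
  by inversion r as [? ? ? ? h|? ? ? ? ? ? ? ? h]; subst; case/spath1_bag: h.
suff: forall t, route t x p y -> forall k, bag y = last k t.
  by move/(_ _ r i).
move=> t; elim=> {s i x p y r} [i x p y /spath1_bag[]//|].
by move=> i s x p y x' q y' _ _ _ rs IH k /=.
Qed.

Lemma route_cat s t x p y x' q y' :
  route s x p y -> adj y x' -> route t x' q y' -> ~~ has (mem s) t ->
  route (s ++ t) x (p ++ x' :: q) y'.
Proof.
move=> r yx' rt; elim: r yx' => {s x p y} [i x p y xp yx' st|].
  apply: route_cons xp _ yx' rt.
  by apply: contraNN st => it; apply/hasP; exists i; rewrite //= mem_head.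
move=> i s x p y z r y0 xp iNs yz _ IH y0x' st.
rewrite -catA /=; apply: route_cons xp _ yz (IH y0x' _).
  rewrite mem_cat negb_or iNs /=.
  by apply: contraNN st => it; apply/hasP; exists i; rewrite //= mem_head.
apply: contraNN st => /hasP[j jt js]; apply/hasP; exists j; rewrite //= in_cons.
by apply/orP; right.
Qed.

Definition att i x := [exists l, (bag l == i) && adj l x].

Lemma attI l x : adj l x -> att (bag l) x.
Proof. by move=> lx; apply/existsP; exists l; rewrite eqxx. Qed.

Lemma attP i x : reflect (exists l, bag l = i /\ adj l x) (att i x).
Proof.
apply: (iffP existsP) => [] [l].
  by case/andP=> /eqP; exists l.
by case=> <- lx; exists l; rewrite eqxx.
Qed.

Hypothesis bag_conn : forall i x y, bag x = i -> bag y = i ->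
  connect [rel u v | [&& bag u == i, bag v == i & adj u v]] x y.
Hypothesis bag_adj : forall i j, i != j ->
  exists x y, [/\ bag x = i, bag y = j & adj x y].

Lemma spath1_exists i x y : bag x = i -> bag y = i ->
  exists p, spath [:: i] x p y.
Proof.
move=> xi yi; have /connectP[p0 p0p ->] := bag_conn xi yi.
case: (shortenP p0p) => p pp up _; exists p; apply/and4P; split=> //.
  by apply: sub_path pp => u v /and3P[].
rewrite /= inE xi eqxx /= {up p0 p0p y yi}.
elim: p x pp {xi} => //= z p IHp u /andP[/and3P[_ zi _] pp].
by rewrite inE zi (IHp z).
Qed.

(** The route alternates between paths inside a bag, from the vertex of entry to the vertex of exit,
    and edges provided by [bag_adj]. *)
Lemma route_exists i s x y : uniq (i :: s) -> bag x = i -> bag y = last i s ->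
  exists p, route (i :: s) x p y.
Proof.
elim: s i x => [|j s IHs] i x us xi yl.
  by have [p xp] := spath1_exists xi yl; exists p; apply: route_one.
have ij : i != j by move: us => /= /andP[]; rewrite inE negb_or => /andP[].
have [u [v [ui vj uv]]] := bag_adj ij.
have [|q vq] := IHs j v _ vj yl; first by case/andP: us.
have [p xp] := spath1_exists xi ui; exists (p ++ v :: q).
by apply: route_cons xp _ uv vq; case/andP: us.
Qed.

End Routes.

Ltac uniq_from H :=
  move: H; rewrite /= ?inE ?negb_or; move=> H;
  repeat match goal with K : is_true (_ && _) |- _ =>
    let K1 := fresh in let K2 := fresh in case/andP: K => K1 K2 end;
  repeat (apply/andP; split); by [|rewrite eq_sym].

(** * Gadgets and rigidity modulo a subgroup *)

Section Rigidity.
Variables (G : sgraph) (A : finZmodType) (w : {set G} -> A).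
Variables (I : finType) (bag : G -> I).
Implicit Types (x y z : G) (p q : seq G) (i j : I) (s t : seq I).
Implicit Types (B : {group A}) (M : {set I}).

Hypothesis bag_conn : forall i x y, bag x = i -> bag y = i ->
  connect [rel u v | [&& bag u == i, bag v == i & adj u v]] x y.
Hypothesis bag_adj : forall i j, i != j ->
  exists x y, [/\ bag x = i, bag y = j & adj x y].

Local Notation pw := (path_weight w).
Local Notation spath := (spath bag).
Local Notation route := (route bag).
Local Notation att := (att bag).

(* The path [gp] from [gx] to [gy] runs through the bags [gX] and [gY], and its
   alternative [gq] may also use [gZ]; both are entered from the bag [gL] and
   left to the bag [gR], which makes gadgets composable. *)
Record gadget := Gadget {
  gL : I; gX : I; gY : I; gZ : I; gR : I;
  gx : G; gy : G; gp : seq G; gq : seq G }.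

Definition gbags g := [:: gL g; gX g; gY g; gZ g; gR g].

Definition gshift g := pw (gx g) (gq g) - pw (gx g) (gp g).

Record gadget_ok g : Prop := GadgetOk {
  gadget_uniq : uniq (gbags g);
  gadget_entry : att (gL g) (gx g);
  gadget_exit : att (gR g) (gy g);
  gadget_route : route [:: gX g; gY g] (gx g) (gp g) (gy g);
  gadget_spath : spath [:: gX g; gY g; gZ g] (gx g) (gq g) (gy g) }.

Definition rigid B M := forall g, gadget_ok g -> {subset gbags g <= M} ->
  gshift g \in B.

Lemma rigidS B M M' : M' \subset M -> rigid B M -> rigid B M'.
Proof. by move=> /subsetP M'M rM g gok gM; apply: rM => // i /gM /M'M. Qed.

(** A route [r] through [X] and [Y] alone is the short path of two gadgets, one with alternative [p]
    and one with alternative [q]; rigidity makes both congruent to [r]. *)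
Lemma rigid_spath B M L X Y Z R x y p q : rigid B M ->
  uniq [:: L; X; Y; Z; R] -> {subset [:: L; X; Y; Z; R] <= M} ->
  att L x -> att R y -> bag x = X -> bag y = Y ->
  spath [:: X; Y; Z] x p y -> spath [:: X; Y; Z] x q y ->
  congr_mod B (pw x p) (pw x q).
Proof.
move=> rM us sM Lx Ry xX yY xp xq.
have [|r xr] := route_exists (s := [:: Y]) bag_conn bag_adj _ xX yY.
  by uniq_from us.
have rigid_r p' : spath [:: X; Y; Z] x p' y -> congr_mod B (pw x p') (pw x r).
  move=> xp'; exact: (rM (Gadget L X Y Z R x y r p')).
exact: congr_mod_trans (rigid_r _ xp) (congr_mod_sym (rigid_r _ xq)).
Qed.

Lemma route_inv i j s x p y : route (i :: j :: s) x p y ->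
  exists p1 u v p2, [/\ spath [:: i] x p1 u, adj u v,
    route (j :: s) v p2 y & p = p1 ++ v :: p2].
Proof.
move=> r; inversion r as [|? ? ? p1 u v p2]; subst.
by exists p1, u, v, p2.
Qed.

(* The bags of [mid] are deleted one at a time: the part of the path inside [U],
   the deleted bag and the next bag is the long path of a gadget. *)
Lemma rigid_route B M L U mid V R Z x p y q : rigid B M ->
  uniq (L :: U :: rcons mid V ++ [:: R; Z]) ->
  {subset L :: U :: rcons mid V ++ [:: R; Z] <= M} ->
  att L x -> att R y ->
  route (U :: rcons mid V) x p y -> route [:: U; V] x q y ->
  congr_mod B (pw x p) (pw x q).
Proof.
move=> rM + + Lx Ry + xq; have [xU yV] := route_bag xq.
elim: mid p => [|T0 mid IHmid] p us sM xp.
  (* There is no bag to delete: both paths stay in [U] and [V], and [Z] fills the place of the third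
     bag. *)
  apply: (@rigid_spath B M L U V Z R x y p q) => //.
  - by uniq_from us.
  - move=> i; move: (sM i); rewrite !inE; do !case: eqP => //=.
  - apply: spath_sub (route_spath xp) => i; rewrite !inE; by do !case: eqP.
  - apply: spath_sub (route_spath xq) => i; rewrite !inE; by do !case: eqP.
case: mid IHmid us sM xp => [|T mid] IHmid us sM xp.
  (* A single inner bag [T0] is itself the third bag of the gadget. *)
  apply: (@rigid_spath B M L U V T0 R x y p q) => //.
  - by uniq_from us.
  - move=> i; move: (sM i); rewrite !inE; do !case: eqP => //=.
  - apply: spath_sub (route_spath xp) => i; rewrite !inE; by do !case: eqP.
  - apply: spath_sub (route_spath xq) => i; rewrite !inE; by do !case: eqP.
(* [R'] follows [T] on the route and is the exit bag of a gadget on [U] and [T] with third bag [T0];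
   this gadget removes [T0]. *)
have [R' [s def_s]] : exists R' s, rcons mid V = R' :: s.
  by case: (mid) => [|a s]; eexists; eexists; reflexivity.
rewrite !rcons_cons def_s in IHmid us sM xp.
have [p1 [u [v [p2 [xp1 uv vp2 def_p]]]]] := route_inv xp.
have [p3 [u' [v' [p4 [vp3 uv' vp4 def_p2]]]]] := route_inv vp2.
have [p5 [u2 [v2 [p6 [vp5 uv2 vp6 def_p4]]]]] := route_inv vp4.
have [_ u2T] := spath1_bag vp5; have [v2R _] := route_bag vp6.
have us5 : uniq [:: L; U; T0; T; R'].
  by move: us; rewrite (cat_uniq [:: L; U; T0; T; R']) => /andP[].
have [|r xr] := route_exists (s := [:: T]) bag_conn bag_adj _ xU u2T.
  by uniq_from us5.
have xq0 : route [:: U; T0; T] x (p1 ++ v :: p3 ++ v' :: p5) u2.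
  apply: route_cons xp1 _ uv _; first by uniq_from us5.
  apply: route_cons vp3 _ uv' _; first by uniq_from us5.
  exact: route_one vp5.
have Ru2 : att R' u2 by rewrite -v2R attI // adj_sym.
have eq_r : congr_mod B (pw x (p1 ++ v :: p3 ++ v' :: p5)) (pw x r).
  apply: (@rigid_spath B M L U T T0 R' x u2) => //.
  - by uniq_from us5.
  - move=> i iL; apply: sM; move: iL; rewrite !inE; by do !case: eqP.
  - apply: spath_sub (route_spath xq0) => i; rewrite !inE; by do !case: eqP.
  - apply: spath_sub (route_spath xr) => i; rewrite !inE; by do !case: eqP.
have UT : U \notin T :: R' :: s.
  move: us => /= /and3P[_ + _]; rewrite !inE !negb_or mem_cat negb_or.
  by case/and4P=> _ -> -> /andP[-> _].
have xp' : route (U :: T :: R' :: s) x (r ++ v2 :: p6) y.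
  apply: (@route_cat _ _ _ [:: U; T] (R' :: s)) xr uv2 vp6 _.
  apply/hasPn=> i; rewrite /= !inE => iR; apply/norP; split.
    by apply: contraNN UT => /eqP <-; rewrite !in_cons iR orbT.
  move: us => /= /and5P[_ _ _ + _]; rewrite -cat_cons mem_cat negb_or.
  by case/andP=> + _; apply: contraNN => /eqP <-.
have us' : uniq (L :: U :: T :: R' :: s ++ [:: R; Z]).
  apply: subseq_uniq us; apply: (@cat_subseq _ [:: L; U] _ [:: L; U]) => //.
  exact: subseq_cons.
have sM' : {subset L :: U :: T :: R' :: s ++ [:: R; Z] <= M}.
  by move=> i iL; apply: sM; move: iL; rewrite !inE; do !case: eqP.
apply: congr_mod_trans (IHmid _ us' sM' xp').
rewrite def_p def_p2 def_p4.
have -> : p1 ++ v :: p3 ++ v' :: p5 ++ v2 :: p6 =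
  (p1 ++ v :: p3 ++ v' :: p5) ++ v2 :: p6 by rewrite -!catA /= -!catA.
rewrite pw_cat [in X in congr_mod _ _ X]pw_cat.
rewrite (spath_last (route_spath xq0)) (spath_last (route_spath xr)).
by rewrite congr_modDr.
Qed.

End Rigidity.

(** * Chains of gadgets and the subset sums of their shifts *)

Section Chains.
Variables (G : sgraph) (A : finZmodType) (w : {set G} -> A).
Variables (I : finType) (bag : G -> I).
Implicit Types (x y z : G) (p q : seq G) (i j : I).
Implicit Types (B C : {group A}) (M : {set I}).

Hypothesis bag_conn : forall i x y, bag x = i -> bag y = i ->
  connect [rel u v | [&& bag u == i, bag v == i & adj u v]] x y.
Hypothesis bag_adj : forall i j, i != j ->
  exists x y, [/\ bag x = i, bag y = j & adj x y].

Local Notation pw := (path_weight w).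
Local Notation spath := (spath bag).
Local Notation route := (route bag).
Local Notation att := (att bag).
Local Notation rigid := (rigid w bag).
Local Notation gshift := (gshift w).
Implicit Types (g : gadget G I) (gs : seq (gadget G I)).

Definition chain_bags gs := flatten (map (@gbags G I) gs).

(** The subset sums: each gadget is either left as it is or switched. *)
Definition shifts gs : {set A} :=
  foldr (fun g S => S :|: [set gshift g + a | a in S]) [set 0] gs.

Fixpoint chain_ok gs : Prop :=
  if gs is g :: gs' then gadget_ok bag g /\ chain_ok gs' else True.

(** The base path follows [gp] in every gadget and is therefore a route; switching a selection of
    gadgets to [gq] adds the sum of their shifts. The induction restarts in the bag [R] to which the
    first gadget exits. *)
Lemma chain_routes gs U V s t :
  chain_ok gs -> uniq (U :: V :: chain_bags gs) -> bag s = U -> bag t = V ->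
  exists mid p, [/\ {subset mid <= chain_bags gs}, route (U :: rcons mid V) s p t
    & forall a, a \in shifts gs ->
        exists q, spath (U :: V :: chain_bags gs) s q t /\ pw s q = pw s p + a].
Proof.
elim: gs U s => [|g gs IHgs] U s /=.
  move=> _ uUV sU tV.
  have [p sp] := route_exists (s := [:: V]) bag_conn bag_adj uUV sU tV.
  exists [::], p; split=> // a; rewrite inE => /eqP ->; exists p.
  by rewrite addr0 (route_spath sp).
case: g => L X Y Z R x y gp gq [[ug /attP[l [lL lx]] /attP[r [rR ry]] xp xq] okgs].
rewrite /= in ug xp xq.
rewrite -[chain_bags _]/([:: L; X; Y; Z; R] ++ chain_bags gs) => uUV sU tV.
(* The bags are permuted into the three blocks that the concatenated path visits in turn. *)
have uUV' : uniq ([:: U; L] ++ [:: X; Y; Z] ++ R :: V :: chain_bags gs).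
  rewrite -(perm_uniq (s1 := U :: V :: [:: L; X; Y; Z; R] ++ chain_bags gs)) //.
  by rewrite perm_cons; apply/permPl/(perm_catCA [:: V] [:: L; X; Y; Z; R]).
have [uUL disUL] : uniq [:: U; L] /\
    ~~ has (mem [:: U; L]) ([:: X; Y; Z] ++ R :: V :: chain_bags gs).
  by move: uUV'; rewrite cat_uniq => /and3P[].
have [uRV disXYZ] : uniq (R :: V :: chain_bags gs) /\
    ~~ has (mem [:: X; Y; Z]) (R :: V :: chain_bags gs).
  by move: uUV'; rewrite !cat_uniq => /and5P[_ _ _ ? ?].
have [mid [p' [sub_mid rp' shiftP]]] := IHgs R r okgs uRV rR tV.
have [p0 sp0] := route_exists (s := [:: L]) bag_conn bag_adj uUL sU lL.
exists [:: L, X, Y, R & mid], (p0 ++ x :: gp ++ r :: p'); split.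
- by move=> i; have := sub_mid i; rewrite !inE; do !case: eqP => //=.
- have sRm : {subset R :: rcons mid V <= R :: V :: chain_bags gs}.
    move=> i; rewrite !inE mem_rcons inE => /or3P[-> //|->|/sub_mid ->];
    by rewrite ?orbT.
  apply: (@route_cat _ _ _ [:: U; L] ([:: X; Y] ++ R :: rcons mid V)) sp0 lx _ _.
    apply: route_cat xp _ rp' _; first by rewrite adj_sym.
    apply: contraNN disXYZ => /hasP[i /sRm iR iX]; apply/hasP; exists i => //.
    by move: iX; rewrite /= !inE => /orP[] ->; rewrite ?orbT.
  apply: contraNN disUL => /hasP[i iR iU]; apply/hasP; exists i => //.
  move: iR; rewrite !mem_cat => /orP[|/sRm ->]; last by rewrite orbT.
  by rewrite !inE => /orP[] ->; rewrite ?orbT.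
have sp0' := route_spath sp0.
have xgp : spath [:: X; Y; Z] x gp y.
  apply: spath_sub (route_spath xp) => i.
  by rewrite !inE => /orP[] ->; rewrite ?orbT.
(* [build] covers both choices for the first gadget: [q0] is [gp] with [a = b], or [gq] with [a]
   equal to its shift plus [b]. *)
have build q0 a b : spath [:: X; Y; Z] x q0 y -> b \in shifts gs ->
    pw x q0 + b = pw x gp + a ->
    exists q, spath (U :: V :: [:: L; X; Y; Z; R] ++ chain_bags gs) s q t /\
      pw s q = pw s (p0 ++ x :: gp ++ r :: p') + a.
  move=> xq0 /shiftP[q' [rq' eq_q']] eq_a; exists (p0 ++ x :: q0 ++ r :: q').
  split.
    have yr : adj y r by rewrite adj_sym.
    have := spath_cat sp0' lx (spath_cat xq0 yr rq' disXYZ) disUL.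
    apply: spath_sub => i.
    by rewrite !(mem_cat, inE); do !case: eqP => //= _.
  rewrite !pw_cat !pw_cons !pw_cat (spath_last xq0) (spath_last xgp) !pw_cons eq_q'.
  rewrite -!addrA; congr (_ + (_ + _)).
  rewrite [w _ + (_ + b)]addrA [_ + b]addrC [LHS]addrA eq_a -addrA.
  congr (_ + _).
  by rewrite addrC -addrA.
move=> a; rewrite inE => /orP[aS|/imsetP[b bS ->]].
  exact: build xgp aS erefl.
apply: build xq bS _; rewrite /gshift /=.
by rewrite addrA [pw x gp + _]addrC subrK.
Qed.

Lemma shifts0 gs : 0 \in shifts gs.
Proof. by elim: gs => [|g gs IHgs] /=; rewrite inE ?IHgs. Qed.

Definition chain_in gs M :=
  [/\ chain_ok gs, uniq (chain_bags gs) & {subset chain_bags gs <= M}].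

Lemma shifts_sub B M gs : rigid B M -> chain_in gs M -> shifts gs \subset B.
Proof.
move=> rM; elim: gs => [|g gs IHgs] /= [okgs ugs sgs].
  by rewrite sub1set zgroup0.
have sub_gs : shifts gs \subset B.
  apply: IHgs; split; first by case: okgs.
    by move: ugs; rewrite /chain_bags /= => /and5P[_ _ _ _ /andP[]].
  by move=> i ig; apply: sgs; rewrite mem_cat ig orbT.
rewrite subUset sub_gs; apply/subsetP=> _ /imsetP[a aS ->].
apply: zgroupD (subsetP sub_gs _ aS); apply: rM; first by case: okgs.
by move=> i ig; apply: sgs; rewrite mem_cat ig.
Qed.

(** One inclusion suffices for a stabilizer: as [S] is finite, [a + S] inside [S] forces
    equality. *)
Definition stab (S : {set A}) := [set a | [forall b in S, a + b \in S]].

Lemma stab_group_set S : group_set (stab S).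
Proof.
apply/group_setP; split; first by rewrite inE; apply/forall_inP=> b; rewrite add0r.
move=> a b; rewrite !inE => /forall_inP aS /forall_inP bS.
by apply/forall_inP=> c cS; rewrite FinRing.zmodMgE -addrA aS ?bS.
Qed.

Canonical stab_group S := Group (stab_group_set S).

Lemma card_shifts_cons g gs :
  gshift g \notin stab (shifts gs) -> (#|shifts gs| < #|shifts (g :: gs)|)%N.
Proof.
rewrite inE negb_forall_in => /exists_inP[b bS dbS]; apply: proper_card.
apply/properP; split; first exact: subsetUl.
by exists (gshift g + b) => //=; rewrite inE imset_f ?orbT.
Qed.

(* As long as some gadget avoiding the chain has its shift outside the
   stabilizer of the set of shifts, prepending it enlarges that set. *)
Lemma greedy_chain B M gs : rigid B M -> chain_in gs M ->
  (size gs < #|shifts gs|)%N ->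
  exists gs', [/\ chain_in gs' M, (size gs' < #|B|)%N
    & B \subset shifts gs' \/ exists C : {group A},
        C \proper B /\ rigid C (M :\: [set i in chain_bags gs'])].
Proof.
(* Each round adds one gadget and at least one new sum, which preserves [size gs < #|shifts gs|];
   rigidity keeps all sums in [B], so this bounds the length of the chain. *)
move=> rM; have [n] := ubnP (#|B| - #|shifts gs|)%N.
elim: n gs => // n IHn gs leBn Mgs ltgs; have sSB := shifts_sub rM Mgs.
have ltgsB : (size gs < #|B|)%N := leq_trans ltgs (subset_leq_card sSB).
(* Because [0] is a sum, every stabilizing element is itself a sum. So [B] consists of sums if it
   stabilizes, and the stabilizer always lies in [B]. *)
have [BS|nBS] := boolP (B \subset stab (shifts gs)).
  exists gs; split=> //; left; apply/subsetP=> b /(subsetP BS).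
  by rewrite inE => /forall_inP/(_ 0); rewrite addr0; apply; apply: shifts0.
have pCB : stab_group (shifts gs) \proper B.
  rewrite properE nBS andbT; apply/subsetP=> a; rewrite inE.
  by move/forall_inP/(_ _ (shifts0 gs)); rewrite addr0 => /(subsetP sSB).
(* The case distinction is classical: gadgets carry sequences and do not form a finite type. *)
have [rC|nrC] := classic
    (rigid (stab_group (shifts gs)) (M :\: [set i in chain_bags gs])).
  by exists gs; split=> //; right; exists (stab_group (shifts gs)).
have [g [okg sgM dg]] : exists g, [/\ gadget_ok bag g,
    {subset gbags g <= M :\: [set i in chain_bags gs]}
    & gshift g \notin stab (shifts gs)].
  apply: NNPP => no_g; apply: nrC => g okg sgM; apply: contraT => dg.
  by case: no_g; exists g.
have Mggs : chain_in (g :: gs) M.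
  case: Mgs => okgs ugs sgs; split=> //.
    rewrite -[chain_bags _]/(gbags g ++ chain_bags gs) cat_uniq.
    rewrite (gadget_uniq okg) ugs andbT; apply/hasPn=> i igs; apply/negP=> /sgM.
    by rewrite !inE igs.
  move=> i; rewrite mem_cat => /orP[/sgM|/sgs //].
  by rewrite inE => /andP[].
have lt1 := card_shifts_cons dg; have sSB' := shifts_sub rM Mggs.
apply: (IHn (g :: gs)) => //; last exact: leq_ltn_trans ltgs lt1.
apply: leq_trans (leBn : (_ - _ <= n)%N).
by apply: ltn_sub2l => //; apply: leq_trans lt1 (subset_leq_card sSB').
Qed.

End Chains.

(** * Disjoint chains under a shrinking group *)

Section ManyChains.
Variables (G : sgraph) (A : finZmodType) (w : {set G} -> A).
Variables (I : finType) (bag : G -> I).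
Implicit Types (B C : {group A}) (M : {set I}).

Local Notation rigid := (rigid w bag).
Implicit Types (g : gadget G I) (gs : seq (gadget G I)).

(* [M1] and [B1] are the minor and the group at the time when the chain was
   built; the current [M] and [B] may have shrunk since then. *)
Definition good_chain gs M B :=
  exists M1 B1, [/\ rigid B1 M1, M \subset M1, {subset chain_bags gs <= M1},
    B \subset B1 & B1 \subset shifts w gs] /\ chain_ok bag gs.

Lemma size_chain_bags gs : size (chain_bags gs) = (5 * size gs)%N.
Proof. by elim: gs => //= g gs; rewrite /chain_bags => ->; lia. Qed.

(** Induction on [k], then on the order of [B]. A chain has fewer than [#|B|] gadgets of five bags,
    within the [7 * #|B|] bags reserved for it. After a failure its bags are discarded and the
    chains still wanted are sought modulo [C]: halving the group frees at least half of
    [7 * k * #|B| + 14 * #|B|], which pays for the loss. The summand [c] is a reserve for the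
    claws. *)
Lemma many_chains k B M c :
  rigid B M -> (7 * k * #|B| + 14 * #|B| + c <= #|M|)%N ->
  exists css M' B', [/\ size css = k, uniq (flatten (map (@chain_bags G I) css)),
      M' \subset M, {subset flatten (map (@chain_bags G I) css) <= M :\: M'}
      & B' \subset B] /\
    [/\ (14 + c <= #|M'|)%N, rigid B' M'
      & forall j, (j < k)%N -> good_chain (nth [::] css j) M' B'].
Proof.
elim: k B M => [|k IHk] B M rM leM.
  exists [::], M, B; split; split=> //.
  by have := cardG_gt0 B; lia.
have [n] := ubnP #|B|; elim: n B M rM leM => // n IHn B M rM leM leBn.
have M0 : chain_in bag [::] M by [].
have [|gs [[okgs ugs sgsM] ltgs Bgs]] := greedy_chain rM M0.
  by rewrite /= cards1.
set M2 := M :\: [set i in chain_bags gs].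
have sM2 : M2 \subset M := subsetDl _ _.
have leM2 : (#|M| <= #|M2| + 5 * #|B|)%N.
  have: (#|[set i in chain_bags gs]| <= 5 * size gs)%N.
    by rewrite -size_chain_bags cardsE card_size.
  have := cardsID [set i in chain_bags gs] M; rewrite -/M2.
  have := subset_leq_card (subsetIr M [set i in chain_bags gs]).
  by move: ltgs; lia.
case: Bgs => [Bgs|[C [pCB rC]]].
  have rM2 := rigidS sM2 rM.
  have [|css [M' [B' [[scss ucss sM' sub_css sB'] [leM' rM' good]]]]] :=
    IHk B M2 rM2; first by move: leM leM2; lia.
  exists (gs :: css), M', B'; split; split=> //=.
  - by rewrite scss.
  - rewrite cat_uniq ugs ucss andbT; apply/hasPn=> i /sub_css.
    by rewrite !inE => /and3P[].
  - exact: subset_trans sM' sM2.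
  - move=> i; rewrite mem_cat => /orP[igs|/sub_css]; last first.
      by rewrite !inE => /and3P[-> _ ->].
    rewrite inE sgsM // andbT; apply/negP=> /(subsetP sM').
    by rewrite !inE igs.
  - case=> [_|j ltj] /=; last exact: good.
    exists M, B; split=> //; split=> //.
    exact: subset_trans sM' sM2.
have le2C : (2 * #|C| <= #|B|)%N.
  have /dvdnP[q def_q] := cardSg (proper_sub pCB).
  have ltCB := proper_card pCB; rewrite def_q leq_mul2r; apply/orP; right.
  by case: q def_q ltCB => [|[|q]] //= ->; rewrite ?mul0n ?mul1n ?ltnn ?ltn0.
have leMC : (7 * k.+1 * #|C| + 14 * #|C| + c <= #|M2|)%N.
  have : (k * (2 * #|C|) <= k * #|B|)%N by rewrite leq_mul2l le2C orbT.
  by move: leM leM2 le2C; lia.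
have ltCn : (#|C| < n)%N by have := proper_card pCB; move: leBn; lia.
have [css [M' [B' [[scss ucss sM' sub_css sB'] Hgood]]]] := IHn C M2 rC leMC ltCn.
exists css, M', B'; split=> //; split=> //.
- exact: subset_trans sM' sM2.
- by move=> i /sub_css; rewrite !inE => /and3P[-> _ ->].
- exact: subset_trans sB' (proper_sub pCB).
Qed.

End ManyChains.

(** * Claws inside a bag *)

Section Claws.
Variables (G : sgraph) (A : finZmodType) (w : {set G} -> A).
Variables (I : finType) (bag : G -> I).
Implicit Types (x y z : G) (p q : seq G) (i j : I).
Implicit Types (B C : {group A}) (M : {set I}).

Hypothesis bag_conn : forall i x y, bag x = i -> bag y = i ->
  connect [rel u v | [&& bag u == i, bag v == i & adj u v]] x y.
Hypothesis bag_adj : forall i j, i != j ->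
  exists x y, [/\ bag x = i, bag y = j & adj x y].

Local Notation pw := (path_weight w).
Local Notation spath := (spath bag).
Local Notation route := (route bag).

Lemma spath_catI s x p q y : spath s x (p ++ q) y ->
  spath s x p (last x p) /\ spath s (last x p) q y.
Proof.
case/and4P; rewrite cat_path last_cat -cat_cons cat_uniq all_cat.
move=> /andP[xp xq] yq /and3P[up dis uq] /andP[sp sq]; split; apply/and4P.
  by split.
split=> //=; last by rewrite sq (allP sp) // mem_last.
by rewrite uq andbT; apply: contraNN dis => lq; apply/hasP; exists (last x p);
   rewrite //= mem_last.
Qed.

(** The path is cut at its last vertex in [D]; this is how the centre of a claw is found. *)
Lemma spath_last_hit s (D : pred G) x p y : spath s x p y -> has D (x :: p) ->
  exists c q, [/\ D c, spath s c q y & ~~ has D q].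
Proof.
elim: p x => [|z p IHp] x xp.
  by rewrite /= orbF => Dx; exists x, [::].
have [zpD _|zpND] := boolP (has D (z :: p)).
  by apply: IHp zpD; have [] := spath_catI (p := [:: z]) xp.
rewrite -[has D _]/(D x || has D (z :: p)) (negbTE zpND) orbF => Dx.
by exists x, (z :: p).
Qed.

(* Three internally disjoint arms, inside one bag, from a centre [c] to the
   neighbours of three other bags; [s a] is the vertex that arm [a] reaches. *)
Record claw (X : I) (l : 'I_3 -> I) (c : G) (arm : 'I_3 -> seq G)
    (s : 'I_3 -> G) : Prop := Claw {
  claw_spath : forall a, spath [:: X] c (arm a) (last c (arm a));
  claw_adj : forall a, adj (last c (arm a)) (s a);
  claw_bag : forall a, bag (s a) = l a;
  claw_disj : forall a b z, a != b -> z \in arm a -> z \notin arm b }.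

(** Let [t a] in [X] have a neighbour in [l a]. Take paths inside [X] from [t a0] to [t a1] and to
    [t a2]. The last vertex of the second path on the first is the centre: it splits the first path
    into two arms, and the rest of the second path is the third arm. *)
Lemma claw_exists X l : (forall a, X != l a) ->
  exists c arm s, claw X l c arm s.
Proof.
move=> Xl.
have /fin_all_exists[t tP] : forall a, exists t,
    exists s, [/\ bag t = X, bag s = l a & adj t s].
  by move=> a; apply: bag_adj (Xl a).
have {tP} /fin_all_exists[s tP] := tP.
have tX a : bag (t a) = X by case: (tP a).
pose a0 : 'I_3 := @Ordinal 3 0 isT; pose a1 : 'I_3 := @Ordinal 3 1 isT.
pose a2 : 'I_3 := @Ordinal 3 2 isT.
have [p t0p] := spath1_exists bag_conn (tX a0) (tX a1).
have [q t2q] := spath1_exists bag_conn (tX a0) (tX a2).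
have [|c [r [cp cr rp]]] := spath_last_hit (D := mem (t a0 :: p)) t2q.
  by rewrite /= inE eqxx.
have {cp} cp : c \in t a0 :: p := cp.
case/splitPl: cp t0p rp => p1 p2 def_c t0p rp.
have [t0p1 cp2] := spath_catI t0p; rewrite def_c in t0p1 cp2.
have up : uniq ((t a0 :: p1) ++ p2) by case/and4P: t0p.
have t0p1_rev : rev (t a0 :: p1) = c :: rev (belast (t a0) p1).
  by rewrite rev_belast def_c.
pose arm (a : 'I_3) := nth [::] [:: rev (belast (t a0) p1); p2; r] (nat_of_ord a).
have armP : forall a, spath [:: X] c (arm a) (t a).
  case=> [[|[|[|//]]] lt3] /=; rewrite /arm /=.
  - by rewrite (_ : Ordinal _ = a0); [apply: spath_rev t0p1|apply: val_inj].
  - by rewrite (_ : Ordinal _ = a1) //; apply: val_inj.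
  - by rewrite (_ : Ordinal _ = a2) //; apply: val_inj.
have sub0 z : z \in rev (belast (t a0) p1) -> z \in t a0 :: p1.
  by move=> zp1; rewrite -mem_rev t0p1_rev inE zp1 orbT.
have dis01 z : z \in rev (belast (t a0) p1) -> z \notin p2.
  move/sub0=> z1; apply/negP=> z2.
  by move: up; rewrite cat_uniq => /and3P[_ /hasPn/(_ z z2)/negP[]].
have dis02 z : z \in rev (belast (t a0) p1) -> z \notin r.
  move/sub0=> z1; apply/negP=> zr; case/negP: (hasPn rp z zr) => /=.
  by rewrite -cat_cons mem_cat z1.
have dis12 z : z \in p2 -> z \notin r.
  move=> z1; apply/negP=> zr; case/negP: (hasPn rp z zr) => /=.
  by rewrite -cat_cons mem_cat z1 orbT.
exists c, arm, s; split.
- by move=> a; rewrite (spath_last (armP a)); apply: armP.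
- by move=> a; rewrite (spath_last (armP a)); case: (tP a).
- by move=> a; case: (tP a).
case=> [[|[|[|//]]] lt3] [[|[|[|//]]] lt3'] z //; rewrite /arm /= => _ z1.
all: apply/negP=> z2.
- by case/negP: (dis01 _ z1).
- by case/negP: (dis02 _ z1).
- by case/negP: (dis01 _ z2).
- by case/negP: (dis12 _ z1).
- by case/negP: (dis02 _ z2).
- by case/negP: (dis12 _ z2).
Qed.

Definition arm_weight c (arm : 'I_3 -> seq G) (s : 'I_3 -> G) a :=
  pw c (arm a) + w [set last c (arm a); s a].

(** The arms [a] and [b] meet only in the centre, so the first reversed and then the second form one
    simple path inside [X], which links the two given routes. *)
Lemma claw_crossing X l c arm s a b S T x u v y : claw X l c arm s -> a != b ->
  uniq (S ++ X :: T) -> route S x u (s a) -> route T (s b) v y ->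
  exists p, route (S ++ X :: T) x p y /\
    pw x p = pw x u + arm_weight c arm s a + (arm_weight c arm s b + pw (s b) v).
Proof.
move=> cl ab uST xu sv; have [Hp Hadj _ Hd] := cl.
pose ta := last c (arm a).
have acr := spath_rev (Hp a).
have cross : spath [:: X] ta (rev (belast c (arm a)) ++ arm b) (last c (arm b)).
  case/and4P: (Hp a) (Hp b) (acr) => [_ _ ua Xa] /and4P[cpb _ ub Xb].
  case/and4P=> [cpa /eqP lc ua' Xa']; apply/and4P; split.
  - by rewrite cat_path cpa lc.
  - by rewrite last_cat lc.
  - rewrite -cat_cons cat_uniq ua' andTb; apply/andP; split; last by case/andP: ub.
    rewrite -rev_belast; apply/hasPn=> z zb /=; rewrite mem_rev inE negb_or.
    have -> : z != c by apply: contraTneq zb => ->; case/andP: ub.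
    by apply: Hd zb; rewrite eq_sym.
  - rewrite -cat_cons all_cat Xa'; case/andP: Xb => _ //.
have [uXT disT] : X \notin T /\ ~~ has (mem S) (X :: T).
  by move: uST; rewrite cat_uniq cons_uniq => /and3P[_ ? /andP[]].
have r1 := route_cons cross uXT (Hadj b) sv.
have sat : adj (s a) ta by rewrite adj_sym; apply: Hadj.
exists (u ++ ta :: ((rev (belast c (arm a)) ++ arm b) ++ s b :: v)).
split; first exact: route_cat xu sat r1 disT.
rewrite pw_cat pw_cons (spath_last (route_spath xu)) pw_cat pw_cons.
rewrite pw_cat pw_rev (spath_last cross) (spath_last acr) setUC.
by rewrite /arm_weight -!addrA; congr (_ + _); rewrite [LHS]addrCA.
Qed.

End Claws.

(** * Pigeonhole on the cosets of [B] in [halving B] *)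

Lemma injection_into (T J : finType) (D : {set J}) :
  (#|T| <= #|D|)%N -> exists e : T -> J, injective e /\ forall t, e t \in D.
Proof.
move=> leTD; exists (fun t => enum_val (widen_ord leTD (enum_rank t))).
split=> [t t' /enum_val_inj/(congr1 val)/= /val_inj/enum_rank_inj //|t].
exact: enum_valP.
Qed.

Lemma halving_group_set (A : finZmodType) (B : {group A}) :
  group_set (halving B).
Proof.
apply/group_setP; split; first by rewrite inE mul0rn zgroup0.
by move=> x y; rewrite !inE => hx hy; rewrite FinRing.zmodMgE mulrnDl zgroupD.
Qed.

Canonical halving_group (A : finZmodType) (B : {group A}) :=
  Group (halving_group_set B).

Lemma halving_sub (A : finZmodType) (B : {group A}) : B \subset halving B.
Proof. by apply/subsetP=> x xB; rewrite inE mulr2n zgroupD. Qed.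

(* Pigeonhole over the at most [sigma A] cosets of [B] in [halving B]. *)
Lemma sigma_pigeonhole (A : finZmodType) (B : {group A}) (V T : finType)
    (phi : T -> A) :
  (forall i j, (phi i - phi j) *+ 2 \in B) -> (#|V| * sigma A <= #|T|)%N ->
  exists h : V -> T, injective h /\ forall x y, phi (h x) - phi (h y) \in B.
Proof.
move=> phi2 leT; have [V0|V_gt0] := posnP #|V|.
  have noV (x : V) : False by have := card0_eq V0 x.
  by exists (fun x => match noV x with end); split=> x; case: (noV x).
have index_gt0 : (0 < #|halving B| %/ #|B|)%N.
  by rewrite divn_gt0 ?cardG_gt0 // subset_leq_card ?halving_sub.
have index_le : (#|halving B| %/ #|B| <= sigma A)%N by apply: leq_bigmax.
have T_gt0 : (0 < #|T|)%N.
  by apply: leq_trans leT; rewrite muln_gt0 V_gt0 (leq_trans index_gt0).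
have i0 : T by apply: (enum_val (Ordinal T_gt0)).
(* Only differences of values of [phi] are known to lie in [halving B], hence the normalization at
   [i0]. *)
pose f i := (B :* (phi i - phi i0 : A))%g.
have fP i : f i \in rcosets B (halving_group B).
  by apply/rcosetsP; exists (phi i - phi i0); rewrite ?inE ?phi2.
have card_im : (#|rcosets B (halving_group B)| <= sigma A)%N.
  rewrite -[#|rcosets _ _|]/(#|halving_group B : B|%g) -divgS.
    exact: index_le.
  exact: halving_sub.
have [y leV] : exists y, (#|V| <= #|[set i | f i == y]|)%N.
  apply/existsP; apply: contraLR leT; rewrite negb_exists => /forallP small.
  rewrite -ltnNge -sum1_card (partition_big f [in rcosets B (halving_group B)]) //=.
  (* If every coset had at most [#|V| - 1] preimages, [#|T|] would be at most
     [sigma A * (#|V| - 1)]. *)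
  apply: (@leq_ltn_trans (\sum_(y in rcosets B (halving_group B)) #|V|.-1)).
    apply: leq_sum => y _; rewrite sum1dep_card -ltnS prednK // ltnNge.
    exact: small.
  rewrite sum_nat_const; apply: leq_ltn_trans (leq_mul card_im (leqnn _)) _.
  rewrite mulnC ltn_mul2r ltn_predL V_gt0 andbT.
  exact: leq_trans index_gt0 index_le.
have [h [h_inj hP]] := injection_into leV.
exists h; split=> // x z; have: f (h x) = f (h z).
  by have := hP x; have := hP z; rewrite !inE => /eqP -> /eqP ->.
move=> eq_f; have: phi (h x) - phi i0 \in f (h z) by rewrite -eq_f rcoset_refl.
rewrite mem_rcoset FinRing.zmodMgE FinRing.zmodVgE.
by rewrite opprB addrA subrK.
Qed.

Lemma third_leg (a b : 'I_3) : exists c, (c != a) && (c != b).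
Proof.
apply/existsP; apply: contraT; rewrite negb_exists => /forallP all_ab.
have: (#|[set: 'I_3]| <= #|[set a; b]|)%N.
  apply/subset_leq_card/subsetP=> c _; move: (all_ab c).
  by rewrite !inE negb_and !negbK.
by rewrite cardsT card_ord cards2; case: (a != b).
Qed.

(** * Systems of claws and their potential modulo [B] *)

Section ClawSystem.
Variables (G : sgraph) (A : finZmodType) (w : {set G} -> A).
Variables (I : finType) (bag : G -> I).
Implicit Types (B : {group A}) (M : {set I}).

Hypothesis bag_conn : forall i x y, bag x = i -> bag y = i ->
  connect [rel u v | [&& bag u == i, bag v == i & adj u v]] x y.
Hypothesis bag_adj : forall i j, i != j ->
  exists x y, [/\ bag x = i, bag y = j & adj x y].

Local Notation pw := (path_weight w).
Local Notation spath := (spath bag).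
Local Notation route := (route bag).
Local Notation rigid := (rigid w bag).
Local Notation arm_weight := (arm_weight w).

(* In a family of bags [e] indexed by [slot V], the bag [e (centre x)] is the
   centre of a claw with legs [e (leg x a)], and the [e (inr k)] are spare. *)
Definition slot (V : finType) := (V * option 'I_3 + 'I_5)%type.
Definition centre (V : finType) (x : V) : slot V := inl (x, None).
Definition leg (V : finType) (x : V) (a : 'I_3) : slot V := inl (x, Some a).

Lemma slot_eqE (V : finType) :
  (forall (x y : V) a b, (leg x a == leg y b) = (x == y) && (a == b)) *
  (forall (x y : V) a, (leg x a == centre y) = false) *
  (forall (x y : V) a, (centre y == leg x a) = false) *
  (forall x y : V, (centre x == centre y) = (x == y)) *
  (forall (x : V) a k, (leg x a == inr k) = false) *
  (forall (x : V) k, (centre x == inr k) = false) *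
  (forall (x : V) a k, (inr k == leg x a) = false) *
  (forall (x : V) k, (inr k == centre x) = false).
Proof. by do !split=> *; rewrite // ?andbF; first [exact: andbF|exact: andbT]. Qed.

Record claw_system (V : finType) (e : slot V -> I) (c : V -> G)
    (arm : V -> 'I_3 -> seq G) (s : V -> 'I_3 -> G) : Prop := ClawSystem {
  system_inj : injective e;
  system_claw : forall x,
    claw bag (e (centre x)) (fun a => e (leg x a)) (c x) (arm x) (s x) }.

Lemma claw_system_exists (V : finType) M :
  (#|{: slot V}| <= #|M|)%N ->
  exists e c arm s, @claw_system V e c arm s /\ forall t, e t \in M.
Proof.
move=> leM; have [e [e_inj eM]] := injection_into leM.
have H x := claw_exists bag_conn bag_adj (X := e (centre x))
  (l := fun a => e (leg x a)).
have {}H x : exists c arm s,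
    claw bag (e (centre x)) (fun a => e (leg x a)) c arm s.
  by apply: H => a; apply/eqP=> /e_inj.
have /fin_all_exists[c {}H] := H; have /fin_all_exists[arm {}H] := H.
have /fin_all_exists[s {}H] := H.
by exists e, c, arm, s.
Qed.

(* The two spare bags [P0], [P1] are a common start and [Q1], [Q0] a common end
   of paths crossing one or two claws; rigidity makes all of them congruent. *)
Lemma claw_potential (V : finType) B M e c arm s : rigid B M ->
  @claw_system V e c arm s -> (forall t, e t \in M) ->
  exists phi : V -> A, forall x y a b r, x != y ->
    route [:: e (leg x a); e (leg y b)] (s x a) r (s y b) ->
    congr_mod B (phi x + (arm_weight (c x) (arm x) (s x) a + pw (s x a) r
       + arm_weight (c y) (arm y) (s y) b)) (phi y).
Proof.
move=> rM [e_inj cl] eM.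
pose sp k (lt5 : (k < 5)%N) : slot V := inr (Ordinal lt5).
pose P0 := e (sp 0 isT); pose P1 := e (sp 1 isT).
pose Q1 := e (sp 2 isT); pose Q0 := e (sp 3 isT); pose Z := e (sp 4 isT).
have ne t t' : t != t' -> e t != e t' by rewrite (inj_eq e_inj).
have [p0 [p1 [p0P p1P p01]]] := bag_adj (ne (sp 0 isT) (sp 1 isT) isT).
have [q0 [q1 [q0Q q1Q q01]]] := bag_adj (ne (sp 3 isT) (sp 2 isT) isT).
have P0p1 : att bag P0 p1 by rewrite /P0 -p0P; apply: attI.
have Q0q1 : att bag Q0 q1 by rewrite /Q0 -q0Q; apply: attI.
have route2 i j x y : i != j -> bag x = i -> bag y = j ->
    exists p, route [:: i; j] x p y.
  by move=> ij xi yj; apply: route_exists; rewrite //= inE ij.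
(* [g] is the reference path: every route from [p1] to [q1] through further bags of the family will
   be congruent to it. *)
have [g p1g] := route2 _ _ _ _ (ne (sp 1 isT) (sp 2 isT) isT) p1P q1Q.
have to_gamma (ts : seq (slot V)) p : uniq (sp 0 isT :: sp 1 isT ::
      rcons ts (sp 2 isT) ++ [:: sp 3 isT; sp 4 isT]) ->
    route (P1 :: rcons [seq e t | t <- ts] Q1) p1 p q1 ->
    congr_mod B (pw p1 p) (pw p1 g).
  move=> uts rp.
  apply: (rigid_route bag_conn bag_adj rM _ _ P0p1 Q0q1 rp p1g (Z := Z)).
    by move: uts; rewrite -(map_inj_uniq e_inj) /= map_cat map_rcons.
  have := (mem_map e_inj); set us := _ :: _ => _ i ius.
  have: i \in [seq e t | t <- sp 0 isT :: sp 1 isT ::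
      rcons ts (sp 2 isT) ++ [:: sp 3 isT; sp 4 isT]].
    by rewrite /= map_cat map_rcons.
  by case/mapP=> t _ ->.
have /fin_all_exists[u uP] : forall xa : V * 'I_3, exists u,
    route [:: P1; e (leg xa.1 xa.2)] p1 u (s xa.1 xa.2).
  by case=> x a; apply: route2 (ne _ _ _) p1P _ => //; case: (cl x).
have /fin_all_exists[v vP] : forall xa : V * 'I_3, exists v,
    route [:: e (leg xa.1 xa.2); Q1] (s xa.1 xa.2) v q1.
  by case=> x a; apply: route2 (ne _ _ _) _ q1Q => //; case: (cl x).
pose al x a := arm_weight (c x) (arm x) (s x) a.
(* [Phi x a] is the weight from [p1] through leg [a] to the centre [c x], and [Psi x a] the weight
   from [c x] through leg [a] to [q1]. *)
pose Phi x a := pw p1 (u (x, a)) + al x a.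
pose Psi x a := al x a + pw (s x a) (v (x, a)).
have rel1 x (a b : 'I_3) : a != b -> congr_mod B (Phi x a + Psi x b) (pw p1 g).
  move=> ab.
  have [|p [rp eq_p]] := claw_crossing w (cl x) ab _ (uP (x, a)) (vP (x, b)).
    rewrite -[_ ++ _]/[seq e t | t <- [:: sp 1 isT; leg x a; centre x;
      leg x b; sp 2 isT]].
    by rewrite (map_inj_uniq e_inj) /= !inE !slot_eqE (negbTE ab) andbF.
  rewrite -eq_p; apply: (to_gamma [:: leg x a; centre x; leg x b] p _ rp).
  by rewrite /= !inE !slot_eqE (negbTE ab) andbF.
(* Leaving by a third leg [b] is possible after arrival by [a] as well as by [ord0]; [Psi x b]
   cancels, so the leg of arrival does not matter. *)
have PhiE x a : congr_mod B (Phi x a) (Phi x ord0).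
  have [b /andP[ba b0]] := third_leg a ord0.
  rewrite -(congr_modDr _ (Psi x b)); apply: congr_mod_trans (rel1 _ _ _ _) _.
    by rewrite eq_sym.
  by apply/congr_mod_sym/rel1; rewrite eq_sym.
pose W x y a b r := al x a + pw (s x a) r + al y b.
(* The path enters the claw at [x] by [a'] and leaves it by [a], follows [r], then enters the claw
   at [y] by [b] and leaves it by [b']. *)
have rel2 x y a b a' b' r : x != y -> a' != a -> b != b' ->
    route [:: e (leg x a); e (leg y b)] (s x a) r (s y b) ->
    congr_mod B (Phi x a' + (W x y a b r + Psi y b')) (pw p1 g).
  move=> xy aa bb rr; have yx : y != x by rewrite eq_sym.
  have [|p' [rp' eq_p']] := claw_crossing w (cl y) bb _ rr (vP (y, b')).
    rewrite -[_ ++ _]/[seq e t | t <- [:: leg x a; leg y b; centre y; leg y b';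
      sp 2 isT]].
    by rewrite (map_inj_uniq e_inj) /= !inE !slot_eqE (negbTE bb) (negbTE xy) andbF.
  have [|p [rp eq_p]] := claw_crossing w (cl x) aa _ (uP (x, a')) rp'.
    rewrite -[_ ++ _]/[seq e t | t <- [:: sp 1 isT; leg x a'; centre x; leg x a;
      leg y b; centre y; leg y b'; sp 2 isT]].
    by rewrite (map_inj_uniq e_inj) /= !inE !slot_eqE (negbTE bb) (negbTE aa)
      (negbTE xy) /= ?andbF.
  have -> : Phi x a' + (W x y a b r + Psi y b') = pw p1 p.
    by rewrite eq_p eq_p' /W /Phi /Psi -!addrA.
  apply: (to_gamma [:: leg x a'; centre x; leg x a; leg y b; centre y; leg y b']
    p _ rp).
  by rewrite /= !inE !slot_eqE (negbTE bb) (negbTE aa) (negbTE xy) /= ?andbF.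
exists (fun x => Phi x ord0) => x y a b r xy rr.
have [a' /andP[aa' _]] := third_leg a a.
have [b' /andP[bb' _]] := third_leg b b.
have bbs : b != b' by rewrite eq_sym.
(* Comparison with a path that crosses [y] alone, from [b2] to [b'], cancels [Psi y b']. *)
have [b2 /andP[bb2 _]] := third_leg b' b'.
apply: congr_mod_trans (PhiE y b2).
rewrite -(congr_modDr _ (Psi y b')) -addrA.
apply: congr_mod_trans (congr_mod_sym (rel1 y _ _ bb2)).
apply: congr_mod_trans (rel2 _ _ _ _ _ _ _ xy aa' bbs rr).
by rewrite congr_modDr; apply/congr_mod_sym/PhiE.
Qed.

Lemma balanced_claws (V : finType) B M :
  rigid B M -> (14 + 4 * #|V| * sigma A <= #|M|)%N ->
  exists e c arm s, [/\ @claw_system V e c arm s, forall t, e t \in M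
    & forall x y a b r, x != y ->
      route [:: e (leg x a); e (leg y b)] (s x a) r (s y b) ->
      arm_weight (c x) (arm x) (s x) a + pw (s x a) r
       + arm_weight (c y) (arm y) (s y) b \in B].
Proof.
move=> rM leM; pose K : finType := 'I_(#|V| * sigma A).
(* Each claw takes four bags and five bags are spare, which the summand 14 accommodates. *)
have [|e [c [arm [s [sys eM]]]]] := @claw_system_exists K M.
  by rewrite card_sum card_prod card_option !card_ord; move: leM; lia.
have [phi phiP] := claw_potential rM sys eM.
have [e_inj cl] := sys.
have phi2 i j : (phi i - phi j) *+ 2 \in B.
  have [->|ij] := eqVneq i j; first by rewrite subrr mul0rn zgroup0.
  have ji : j != i by rewrite eq_sym.
  pose a : 'I_3 := ord0.
  have bs x : bag (s x a) = e (leg x a) by case: (cl x).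
  have ne x y : x != y -> e (leg x a) != e (leg y a).
    by move=> xy; rewrite (inj_eq e_inj) slot_eqE negb_and xy.
  have ex x y : x != y -> exists r, route [:: e (leg x a); e (leg y a)]
      (s x a) r (s y a).
    by move=> xy; apply: route_exists => //; rewrite /= inE ne.
  have [r rr] := ex _ _ ij; have [r' rr'] := ex _ _ ji.
  have srr' := spath_rev (route_spath rr').
  (* The reversal of [r'] has the same ends as [r] and stays in the same two legs; the centres are
     the entry and exit bags of the gadget. *)
  have eq_r : congr_mod B (pw (s i a) r) (pw (s j a) r').
    rewrite -(pw_rev w (s j a) r') (spath_last (route_spath rr')).
    have atts x : att bag (e (centre x)) (s x a).
      case: (cl x) => /(_ a) cs /(_ a) ct _ _.
      by have [_ <-] := spath1_bag cs; apply: attI.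
    pose z := e (inr ord0).
    apply: (rigid_spath bag_conn bag_adj rM _ _ (atts i) (atts j) (bs i) (bs j)
      (Z := z)).
    - rewrite -[_ :: _]/[seq e t | t <- [:: centre i; leg i a; leg j a; inr ord0;
        centre j]].
      by rewrite (map_inj_uniq e_inj) /= !inE !slot_eqE (negbTE ij).
    - move=> t; rewrite !inE.
      by case/or4P=> [/eqP->|/eqP->|/eqP->|/orP[] /eqP->]; apply: eM.
    - apply: spath_sub (route_spath rr) => t.
      by rewrite !inE => /orP[] ->; rewrite ?orbT.
    - by apply: spath_sub srr' => t; rewrite !inE => /orP[] ->; rewrite ?orbT.
  set W := arm_weight (c i) (arm i) (s i) a + pw (s i a) r
    + arm_weight (c j) (arm j) (s j) a.
  set W' := arm_weight (c j) (arm j) (s j) a + pw (s j a) r'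
    + arm_weight (c i) (arm i) (s i) a.
  have eq_W : congr_mod B W' W.
    rewrite /W' addrC [in X in congr_mod _ X _]addrCA addrC.
    by rewrite congr_modDr congr_modDl; apply: congr_mod_sym.
  have ji_ij := congr_modD (phiP _ _ _ _ _ ji rr')
    (congr_modN (phiP _ _ _ _ _ ij rr)).
  rewrite -/W -/W' opprD addrACA in ji_ij.
  (* The doubled difference is [phi i - phi j] minus its opposite, and these two are congruent
     because [W'] and [W] are. *)
  rewrite mulr2n -{2}[phi i - phi j]opprB.
  apply: congr_mod_trans (congr_mod_sym ji_ij) _.
  by rewrite -[X in congr_mod _ _ X]addr0 congr_modDl /congr_mod subr0.
have [|h [h_inj hP]] := @sigma_pigeonhole A B V K phi phi2.
  by rewrite card_ord.
pose emb (t : slot V) : slot K := match t with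
  | inl (x, o) => inl (h x, o) | inr k => inr k end.
have emb_inj : injective emb.
  by move=> [[x o]|k] [[y o']|k'] //= [] => [/h_inj -> ->|->].
exists (fun t => e (emb t)), (fun x => c (h x)), (fun x => arm (h x)).
exists (fun x => s (h x)).
split.
- split; first by apply: inj_comp e_inj emb_inj.
  by move=> x; apply: cl.
- by move=> t; apply: eM.
move=> x y a b r xy rr; have hxy : h x != h y by rewrite (inj_eq h_inj).
have := phiP _ _ _ _ _ hxy rr => /congr_mod_trans/(_ (congr_mod_sym (hP x y))).
by rewrite -[X in congr_mod _ _ X]addr0 congr_modDl /congr_mod subr0.
Qed.

End ClawSystem.

(** * From a system of paths in [G] to a subdivision *)

Lemma path_walk_edges (T : finType) (x : T) (p : seq T) :
  path (fun a b => [set a; b] \in walk_edges x p) x p.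
Proof.
elim: p x => //= y p IHp x; rewrite mem_head /=.
by apply: sub_path (IHp y) => a b ab; rewrite in_cons ab orbT.
Qed.

Lemma walk_edges_map (T T' : finType) (f : T -> T') x p :
  walk_edges (f x) (map f p) = map (fun e : {set T} => f @: e) (walk_edges x p).
Proof.
elim: p x => //= y p IHp x; rewrite -/(walk_edges _ _) IHp.
by rewrite imsetU1 imset_set1.
Qed.

Section PathSystem.
Variables (H G : sgraph) (A : finZmodType) (w : {set G} -> A).
Variables (psi : H -> G) (Q : H -> H -> seq G).
Local Notation tail u v := (rcons (Q u v) (psi v)).

Hypothesis psi_inj : injective psi.
Hypothesis Q_rev : forall u v, adj u v -> Q v u = rev (Q u v).
Hypothesis Q_path : forall u v, adj u v -> path (@adj G) (psi u) (tail u v).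
Hypothesis Q_uniq : forall u v, adj u v -> uniq (psi u :: tail u v).
Hypothesis Q_psi : forall u v x, adj u v -> psi x \notin Q u v.
Hypothesis Q_disj : forall u v u' v', adj u v -> adj u' v' ->
  [set u; v] != [set u'; v'] -> [disjoint Q u v & Q u' v'].
Hypothesis Q_sum : forall u v, adj u v -> path_weight w (psi u) (tail u v) = 0.

Definition used (z : G) :=
  [exists x, z == psi x] || [exists u, exists v, adj u v && (z \in Q u v)].

Definition used_vertex : finType := {z : G | used z}.

(** Only traversed edges are kept, not all edges induced by [G], since [sub_edges] allows no
    others. *)
Definition used_adj (a b : used_vertex) := adj (val a) (val b) &&
  [exists u, exists v, adj u v &&
     ([set val a; val b] \in walk_edges (psi u) (tail u v))].

Lemma used_adj_sym : symmetric used_adj.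
Proof.
by move=> a b; rewrite /used_adj adj_sym [[set val a; _]]setUC.
Qed.

Lemma used_adj_irrefl : irreflexive used_adj.
Proof. by move=> a; rewrite /used_adj adj_irrefl. Qed.

Definition used_graph := SGraph used_adj_sym used_adj_irrefl.

Lemma used_psi x : used (psi x).
Proof. by apply/orP; left; apply/existsP; exists x. Qed.

Lemma path_system_subdivision : divisible_subdivision H w.
Proof.
pose phi x : used_graph := exist _ (psi x) (used_psi x).
(* For an edge [uv] all vertices of [Q u v] are used, so [insub] drops none of them. *)
pose P u v : seq used_graph := pmap insub (Q u v).
have valP u v : adj u v -> map val (P u v) = Q u v.
  move=> uv; rewrite (pmap_filter (insubK _)); apply/all_filterP/allP=> z zQ.
  rewrite /= insubT //; apply/orP; right; apply/existsP; exists u.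
  by apply/existsP; exists v; rewrite uv.
have tailP u v : adj u v -> map val (sub_tail phi P u v) = tail u v.
  by move=> uv; rewrite map_rcons valP.
have memP u v z : adj u v -> (z \in P u v) = (val z \in Q u v).
  by move=> uv; rewrite -(valP u v uv) (mem_map val_inj).
have edgeE (a b : used_graph) : [set val a; val b] = val @: [set a; b].
  by rewrite imsetU1 imset_set1.
have walkP u v : adj u v -> walk_edges (psi u) (tail u v) =
    map (fun e : {set used_graph} => val @: e)
      (walk_edges (phi u) (sub_tail phi P u v)).
  by move=> uv; rewrite -walk_edges_map tailP.
exists used_graph, phi, P, val; split.
- split.
  + by move=> x y [/psi_inj].
  + move=> u v uv; have vu : adj v u by rewrite adj_sym.
    by apply: (inj_map val_inj); rewrite map_rev !valP // Q_rev.
  + move=> u v uv.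
    have: path [rel a b | adj a b && ([set a; b] \in
        walk_edges (psi u) (tail u v))] (psi u) (tail u v).
      by rewrite path_relI Q_path // path_walk_edges.
    rewrite -[X in path _ X]/(val (phi u)) -{2}(tailP u v uv) path_map.
    apply: sub_path => a b /andP[ab abQ]; apply/andP; split=> //.
    by apply/existsP; exists u; apply/existsP; exists v; rewrite uv.
  + move=> u v uv; rewrite -(map_inj_uniq val_inj) map_cons tailP //.
    exact: Q_uniq.
  + by move=> u v x uv; rewrite memP // Q_psi.
  + move=> u v u' v' uv uv' ne; apply/pred0P=> z /=; rewrite !memP //.
    exact: (pred0P (Q_disj uv uv' ne)).
  + case=> z z_used; case/orP: (z_used) => [/existsP[x /eqP zx]|].
      by left; exists x; apply: val_inj.
    case/existsP=> u /existsP[v /andP[uv zQ]]; right; exists u, v.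
    by rewrite memP.
  + move=> e /imsetP[[a b]]; rewrite inE => /andP[_ /existsP[u /existsP[v]]].
    case/andP=> uv abQ ->.
    exists u, v; split=> //; move: abQ; rewrite walkP // edgeE mem_map //.
    exact: imset_inj val_inj.
- by split; [apply: val_inj|move=> a b /andP[]].
- by move=> u v uv; have := Q_sum uv; rewrite /path_weight walkP // big_map.
Qed.

End PathSystem.

(** * Subdivision paths built from claws and chains *)

Section Assembly.
Variables (H G : sgraph) (A : finZmodType) (w : {set G} -> A).
Variables (I : finType) (bag : G -> I).

Hypothesis bag_conn : forall i x y, bag x = i -> bag y = i ->
  connect [rel u v | [&& bag u == i, bag v == i & adj u v]] x y.
Hypothesis bag_adj : forall i j, i != j ->
  exists x y, [/\ bag x = i, bag y = j & adj x y].

Local Notation pw := (path_weight w).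
Local Notation arm_weight := (arm_weight w).

Variables (M : {set I}) (B : {group A}).
Variables (e : slot H -> I) (c : H -> G).
Variables (arm : H -> 'I_3 -> seq G) (s : H -> 'I_3 -> G).
Hypothesis sys : claw_system bag e c arm s.
Hypothesis eM : forall t, e t \in M.
Hypothesis balanced : forall x y a b r, x != y ->
  route bag [:: e (leg x a); e (leg y b)] (s x a) r (s y b) ->
  arm_weight (c x) (arm x) (s x) a + pw (s x a) r
    + arm_weight (c y) (arm y) (s y) b \in B.

(** [port u v] is the leg of the claw at [u] reserved for the edge [uv]. *)
Variable port : H -> H -> 'I_3.
Hypothesis port_inj : forall u v v', adj u v -> adj u v' ->
  port u v = port u v' -> v = v'.

Variable chain : H -> H -> seq (gadget G I).
Hypothesis chain_sym : forall u v, chain u v = chain v u.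
Hypothesis chain_good : forall u v, adj u v -> good_chain w bag (chain u v) M B.
Hypothesis chain_uniq : forall u v, adj u v -> uniq (chain_bags (chain u v)).
Hypothesis chain_out : forall u v i, adj u v -> i \in chain_bags (chain u v) ->
  i \notin M.
Hypothesis chain_disj : forall u v u' v' i, adj u v -> adj u' v' ->
  [set u; v] != [set u'; v'] -> i \in chain_bags (chain u v) ->
  i \notin chain_bags (chain u' v').

Let e_inj : injective e := system_inj sys.

Let claw_of x := system_claw sys x.

Lemma adj_neq (K : sgraph) (u v : K) : adj u v -> u != v.
Proof. by apply: contraTneq => ->; rewrite adj_irrefl. Qed.

Lemma bag_arm x a z : z \in c x :: arm x a -> bag z = e (centre x).
Proof.
move=> zx; have := spath_mem (claw_spath (claw_of x) a) zx.
by rewrite inE => /eqP.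
Qed.

Lemma att_leg x a : att bag (e (centre x)) (s x a).
Proof.
rewrite -(bag_arm (mem_last (c x) (arm x a))).
exact: attI (claw_adj (claw_of x) a).
Qed.

(* The part of the claw at [u] used by the edge [uv], except its centre. *)
Definition zone u v (z : G) :=
  (z \in arm u (port u v)) || (bag z == e (leg u (port u v))).

Definition edge_path u v Q : Prop :=
  [/\ path (@adj G) (c u) (rcons Q (c v)), uniq (c u :: rcons Q (c v)),
      pw (c u) (rcons Q (c v)) = 0
    & forall z, z \in Q -> [\/ zone u v z, zone v u z
        | bag z \in chain_bags (chain u v)]].

(** The base path of the chain is congruent to a direct route between the two legs, so with both
    arms its weight lies in [B1]; the chain then supplies the opposite of this weight as a shift. *)
Lemma edge_path_exists u v : adj u v -> exists Q, edge_path u v Q.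
Proof.
move=> uv; have uv_ne := adj_neq uv.
set a := port u v; set b := port v u; set gs := chain u v.
have bag_s x d : bag (s x d) = e (leg x d) by case: (claw_of x).
have out t : e t \notin chain_bags gs.
  by apply/negP=> /(chain_out uv); rewrite eM.
have ne_uv : e (leg u a) != e (leg v b).
  by rewrite (inj_eq e_inj) slot_eqE (negbTE uv_ne).
have uUV : uniq (e (leg u a) :: e (leg v b) :: chain_bags gs).
  by rewrite /= inE negb_or ne_uv !out chain_uniq.
have [M1 [B1 [[rM1 MM1 gsM1 BB1 B1gs] okgs]]] := chain_good uv.
have [mid [p [sub_mid rp shiftP]]] :=
  chain_routes w bag_conn bag_adj okgs uUV (bag_s u a) (bag_s v b).
have [|r rr] := route_exists (s := [:: e (leg v b)]) bag_conn bag_adj _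
  (bag_s u a) (bag_s v b); first by rewrite /= inE ne_uv.
have e1 t : e t \in M1 by apply: (subsetP MM1).
have ne t t' : t != t' -> e t != e t' by rewrite (inj_eq e_inj).
have off_route t : t != leg u a -> t != leg v b ->
    e t \notin e (leg u a) :: rcons mid (e (leg v b)).
  move=> tu tv; rewrite in_cons mem_rcons in_cons !(inj_eq e_inj).
  by rewrite (negbTE tu) (negbTE tv); apply: contraNN (out t) => /sub_mid.
(* Rigidity is used in [M1] modulo [B1], as it held when the chain was built: the inner bags of the
   route are chain bags, which lie outside [M]. *)
have eq_pr : congr_mod B1 (pw (s u a) p) (pw (s u a) r).
  apply: (rigid_route bag_conn bag_adj rM1 _ _ (att_leg u a) (att_leg v b) rp rr
    (Z := e (inr ord0))).
    rewrite cons_uniq -cat_cons cat_uniq; apply/and4P; split.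
    - rewrite mem_cat negb_or off_route ?slot_eqE //=.
      by rewrite !inE !(inj_eq e_inj) !slot_eqE (negbTE uv_ne).
    - exact: route_uniq rp.
    - by apply/hasPn=> i; rewrite !inE => /orP[] /eqP->; apply: off_route;
        rewrite slot_eqE.
    - by rewrite /= inE (inj_eq e_inj).
  move=> i; rewrite 2!in_cons mem_cat mem_rcons in_cons !inE -!orbA.
  do 2![case/orP=> [/eqP-> //|]]; case/or4P=> [/eqP-> //|/sub_mid/gsM1 //||] /eqP->;
  exact: e1.
set al := arm_weight (c u) (arm u) (s u) a.
set be := arm_weight (c v) (arm v) (s v) b.
have totB : al + pw (s u a) p + be \in B1.
  have := subsetP BB1 _ (balanced uv_ne rr); rewrite -/al -/be => totr.
  suff: congr_mod B1 (al + pw (s u a) p + be) (al + pw (s u a) r + be).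
    by move/zgroupD/(_ totr); rewrite subrK.
  by rewrite congr_modDr congr_modDl.
have [q [sq eq_q]] := shiftP _ (subsetP B1gs _ (zgroupN totB)).
have su := claw_spath (claw_of u) a.
have sv := spath_rev (claw_spath (claw_of v) b).
have adju := claw_adj (claw_of u) a; have adjv := claw_adj (claw_of v) b.
rewrite adj_sym in adjv.
have rev_arm : last (c v) (arm v b) :: rev (belast (c v) (arm v b)) =
    rcons (rev (arm v b)) (c v) by rewrite -rev_belast rev_cons.
have /and4P[fp /eqP fl fu _] : spath bag
    ([:: e (centre u)] ++ (e (leg u a) :: e (leg v b) :: chain_bags gs) ++
      [:: e (centre v)]) (c u)
    (arm u a ++ s u a :: q ++ last (c v) (arm v b) ::
      rev (belast (c v) (arm v b))) (c v).
  apply: spath_cat su adju (spath_cat sq adjv sv _) _.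
    rewrite /= orbF !inE !(inj_eq e_inj) !slot_eqE /=; exact: out.
  rewrite has_cat negb_or; apply/andP; split; last first.
    by rewrite /= orbF inE (inj_eq e_inj) slot_eqE eq_sym.
  apply/hasPn=> i iU; rewrite /= mem_seq1; apply: contraTneq iU => ->.
  by rewrite !inE !(inj_eq e_inj) !slot_eqE /= out.
exists (arm u a ++ s u a :: q ++ rev (arm v b)).
have def_tail : rcons (arm u a ++ s u a :: q ++ rev (arm v b)) (c v) =
  arm u a ++ s u a :: q ++ last (c v) (arm v b) :: rev (belast (c v) (arm v b)).
  by rewrite rev_arm rcons_cat rcons_cons rcons_cat.
split; rewrite ?def_tail //.
- rewrite pw_cat pw_cons pw_cat pw_cons pw_rev (spath_last sq) eq_q.
  have -> : w [set s v b; last (c v) (arm v b)] + pw (c v) (arm v b) = be.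
    by rewrite addrC setUC.
  rewrite addrA -[pw (c u) (arm u a) + _]/al; clearbody al be.
  by rewrite !addrA [LHS]addrAC subrr.
- move=> z; rewrite mem_cat in_cons mem_cat mem_rev.
  case/or4P=> [zu|/eqP->|zq|zv].
  + by apply: Or31; rewrite /zone zu.
  + by apply: Or31; rewrite /zone bag_s eqxx orbT.
  + have: bag z \in e (leg u a) :: e (leg v b) :: chain_bags gs.
      by apply: (spath_mem sq); rewrite in_cons zq orbT.
    rewrite !in_cons => /or3P[zu|zv|]; last by apply: Or33.
    * by apply: Or31; rewrite /zone zu orbT.
    * by apply: Or32; rewrite /zone zv orbT.
  + by apply: Or32; rewrite /zone zv.
Qed.

Lemma edge_path_rev u v Q : adj u v -> edge_path u v Q -> edge_path v u (rev Q).
Proof.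
move=> uv [pQ uQ wQ zQ].
have def_tail : rcons (rev Q) (c u) = rev (belast (c u) (rcons Q (c v))).
  by rewrite belast_rcons rev_cons.
have lastQ : last (c u) (rcons Q (c v)) = c v by rewrite last_rcons.
split; rewrite ?def_tail.
- have := rev_path (@adj G) (c u) (rcons Q (c v)); rewrite lastQ => ->.
  by rewrite (@eq_path _ _ (@adj G)) // => x y; rewrite adj_sym.
- by have := rev_belast (c u) (rcons Q (c v)); rewrite lastQ => <-; rewrite rev_uniq.
- by have := pw_rev w (c u) (rcons Q (c v)); rewrite lastQ => ->.
- move=> z; rewrite mem_rev => /zQ[zu|zv|zc].
  + exact: Or32.
  + exact: Or31.
  + by apply: Or33; rewrite chain_sym.
Qed.

Lemma zone_in u v z : zone u v z -> bag z \in M.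
Proof.
case/orP=> [za|/eqP-> //].
by rewrite (@bag_arm u (port u v)) // in_cons za orbT.
Qed.

(** Distinct arms of one claw are disjoint, as they omit the centre; other collisions contradict the
    injectivity of [e]. The leg then determines [v] by [port_inj]. *)
Lemma zone_eq u v u' v' z : adj u v -> adj u' v' ->
  zone u v z -> zone u' v' z -> u = u' /\ v = v'.
Proof.
move=> uv uv'; set a := port u v; set a' := port u' v'.
suff Huv : zone u v z -> zone u' v' z -> u = u' /\ a = a'.
  move=> z1 z2; have [def_u eq_a] := Huv z1 z2; split=> //.
  by move: uv' eq_a; rewrite /a /a' -def_u => uv'; apply: port_inj.
have armE x d : z \in arm x d -> bag z = e (centre x).
  by move=> za; rewrite (@bag_arm x d) // in_cons za orbT.
case/orP=> [z1|/eqP z1] /orP[z2|/eqP z2].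
- have := armE _ _ z1; rewrite (armE _ _ z2) => /e_inj/eqP.
  rewrite slot_eqE => /eqP def_u; split=> //; apply/eqP; apply: contraT => ne_a.
  move: z2; rewrite -/a' def_u => z2.
  by have := claw_disj (claw_of u) ne_a z1; rewrite z2.
- by move: z2; rewrite (armE _ _ z1) => /e_inj/eqP; rewrite slot_eqE.
- by move: z1; rewrite (armE _ _ z2) => /e_inj/eqP; rewrite slot_eqE.
- move: z1; rewrite z2 => /e_inj/eqP.
  by rewrite slot_eqE => /andP[/eqP def_u /eqP eq_a]; split; apply: esym.
Qed.

Lemma claws_and_chains_subdivision : divisible_subdivision H w.
Proof.
have /fin_all_exists[q qP] : forall uv : H * H, exists Q,
    adj uv.1 uv.2 -> edge_path uv.1 uv.2 Q.
  case=> u v; have [uv|_] := boolP (adj u v); last by exists [::].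
  by have [Q] := edge_path_exists uv; exists Q.
(* The path is chosen for one orientation of each edge, picked by rank, and reversed for the
   other. *)
pose Q u v := if (enum_rank u < enum_rank v)%N then q (u, v) else rev (q (v, u)).
have QP u v : adj u v -> edge_path u v (Q u v).
  rewrite /Q => uv; case: ifP => _; first exact: (qP (u, v)).
  have vu : adj v u by rewrite adj_sym.
  by apply: edge_path_rev => //; apply: (qP (v, u)).
(* An arm continues a simple path that starts at the centre, so it does not return there. *)
have c_zone x u v : ~~ zone u v (c x).
  have bag_c : bag (c x) = e (centre x) by apply: (@bag_arm x ord0); apply: mem_head.
  rewrite /zone negb_or bag_c (inj_eq e_inj) slot_eqE andbT.
  apply/negP=> cx; have := @bag_arm u (port u v) (c x).
  rewrite in_cons cx orbT bag_c => /(_ isT)/e_inj/eqP; rewrite slot_eqE => /eqP xu.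
  have /and4P[_ _] := claw_spath (claw_of u) (port u v).
  by rewrite -xu in cx *; rewrite /= cx.
apply: (@path_system_subdivision _ _ _ _ c Q).
- move=> x y cxy; have := @bag_arm x ord0 _ (mem_head _ _).
  rewrite cxy (@bag_arm y ord0) ?mem_head // => /e_inj/eqP.
  by rewrite slot_eqE => /eqP.
- move=> u v uv; rewrite /Q; case: (ltngtP (enum_rank u) (enum_rank v)) => //.
    by rewrite revK.
  by move/val_inj/enum_rank_inj=> def_u; have := adj_neq uv; rewrite def_u eqxx.
- by move=> u v /QP[].
- by move=> u v /QP[].
- move=> u v x uv; apply/negP=> /(let: And4 _ _ _ h := QP _ _ uv in h).
  case; [exact/negP/c_zone|exact/negP/c_zone|].
  move/(chain_out uv)/negP; apply.
  by rewrite (@bag_arm x ord0) ?mem_head.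
- move=> u v u' v' uv uv' ne; apply/pred0P=> z /=; apply/negP=> /andP[zQ zQ'].
  have vu : adj v u by rewrite adj_sym.
  have vu' : adj v' u' by rewrite adj_sym.
  have [_ _ _ /(_ z zQ) Hz] := QP _ _ uv; have [_ _ _ /(_ z zQ') Hz'] := QP _ _ uv'.
  have noz x y x' y' : adj x y -> adj x' y' -> [set x; y] != [set x'; y'] ->
      zone x y z -> zone x' y' z -> False.
    by move=> xy xy' + z1 z2; have [-> ->] := zone_eq xy xy' z1 z2; rewrite eqxx.
  have noc x y x' y' : adj x y -> zone x' y' z ->
      bag z \in chain_bags (chain x y) -> False.
    by move=> xy /zone_in zM /(chain_out xy)/negP.
  have ne1 : [set v; u] != [set u'; v'] by rewrite setUC.
  have ne2 : [set u; v] != [set v'; u'] by rewrite [X in _ != X]setUC.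
  have ne3 : [set v; u] != [set v'; u'] by rewrite setUC [X in _ != X]setUC.
  (* Two zones are separated by [zone_eq], a zone and a chain by [chain_out], two chains by
     [chain_disj]. *)
  case: Hz Hz' => [z1|z1|z1] [z2|z2|z2].
  + exact: noz ne z1 z2.
  + exact: noz ne2 z1 z2.
  + exact: noc uv' z1 z2.
  + exact: noz ne1 z1 z2.
  + exact: noz ne3 z1 z2.
  + exact: noc uv' z1 z2.
  + exact: noc uv z2 z1.
  + exact: noc uv z2 z1.
  + by have := chain_disj uv uv' ne z1; rewrite z2.
- by move=> u v /QP[].
Qed.

End Assembly.

(** * Assigning chains and legs to the edges of [H] *)

Lemma mem_nth_flatten (T : eqType) (ss : seq (seq T)) j i :
  i \in nth [::] ss j -> i \in flatten ss.
Proof.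
elim: ss j => [|t ss IHss] [|j] //= ij; rewrite mem_cat ?ij //.
by rewrite (IHss j) ?orbT.
Qed.

Lemma uniq_nth_flatten (T : eqType) (ss : seq (seq T)) j :
  uniq (flatten ss) -> uniq (nth [::] ss j).
Proof.
elim: ss j => [|t ss IHss] [|j] //=; rewrite cat_uniq => /and3P[// _ _].
exact: IHss.
Qed.

Lemma nth_flatten_inj (T : eqType) (ss : seq (seq T)) j j' i :
  uniq (flatten ss) -> i \in nth [::] ss j -> i \in nth [::] ss j' -> j = j'.
Proof.
elim: ss j j' => [|t ss IHss] [|j] [|j'] //=; rewrite cat_uniq.
all: case/and3P=> _ /hasPn dis uss ij ij'.
- by have := dis _ (mem_nth_flatten ij'); rewrite /= ij.
- by have := dis _ (mem_nth_flatten ij); rewrite /= ij'.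
- by rewrite (IHss j j').
Qed.

Local Close Scope ring_scope.

Theorem theorem1p3 (H : sgraph) (n m : nat) (A : finZmodType) (f : nat)
    (G : sgraph) (w : {set G} -> A) :
  #|H| = n -> #|edges H| = m -> max_degree H <= 3 ->
  7 * m * #|A| + 4 * n * sigma A + 14 * #|A| <= f ->
  clique_minor f G ->
  divisible_subdivision H w.
Proof.
move=> cardH cardE_m deg3 lef [X [X0 Xdis Xcov Xconn Xadj]].
have /fin_all_exists[bag bagX] : forall z : G, exists i, z \in X i.
  move=> z; have : z \in \bigcup_(i < f) X i by rewrite Xcov.
  by case/bigcupP=> i _; exists i.
have bagE z i : (bag z == i) = (z \in X i).
  apply/eqP/idP=> [<-|zi]; first exact: bagX.
  apply/eqP; apply: contraT => /Xdis; rewrite -setI_eq0 => /eqP/setP/(_ z).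
  by rewrite !inE bagX zi.
have bag_conn i x y : bag x = i -> bag y = i ->
    connect [rel u v | [&& bag u == i, bag v == i & adj u v]] x y.
  move/eqP; rewrite bagE => xi /eqP; rewrite bagE => yi.
  rewrite (eq_connect (e' := [rel u v : G | [&& u \in X i, v \in X i & adj u v]])).
    exact: Xconn.
  by move=> u v /=; rewrite !bagE.
have bag_adj i j : i != j -> exists x y, [/\ bag x = i, bag y = j & adj x y].
  move=> /Xadj[x [y [xi yj xy]]]; exists x, y.
  by split=> //; apply/eqP; rewrite bagE.
(* Modulo the whole group every minor is rigid; the descent starts here. *)
have rA : rigid w bag [set: A]%G [set: 'I_f] by move=> g _ _; rewrite inE.
have [|css [M [B [[scss ucss _ sub_css _] [leM rM good]]]]] :=
  many_chains (k := m) (c := 4 * n * sigma A) rA.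
  by rewrite !cardsT card_ord addnAC; exact: lef.
have [|e [c [arm [s [sys eM bal]]]]] := balanced_claws bag_conn bag_adj (V := H) rM.
  by rewrite cardH.
(* Both orientations of an edge get the same index, hence the same chain. *)
pose ix (u v : H) := index [set u; v] (enum (edges H)).
have edgeP (u v : H) : adj u v -> [set u; v] \in enum (edges H).
  by move=> uv; rewrite mem_enum; apply/imsetP; exists (u, v); rewrite ?inE.
have ltix u v : adj u v -> (ix u v < m)%N.
  by move=> uv; rewrite -cardE_m cardE index_mem edgeP.
have chainE u v : adj u v -> chain_bags (nth [::] css (ix u v)) =
    nth [::] (map (@chain_bags G 'I_f) css) (ix u v).
  by move=> uv; rewrite (nth_map [::]) // scss ltix.
have ixC u v : ix u v = ix v u by rewrite /ix setUC.
pose nbrs (u : H) := enum [set y | adj u y].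
have lt3 u v : adj u v -> (index v (nbrs u) < 3)%N.
  move=> uv; apply: leq_trans deg3; apply: leq_trans (leq_bigmax u).
  by rewrite /degree cardE index_mem mem_enum inE.
(* The leg for [uv] at [u] is the position of [v] among the neighbours of [u]; the degree bound
   keeps it below 3, where [inord] is faithful. *)
apply: (@claws_and_chains_subdivision H G A w _ bag bag_conn bag_adj M B e c arm
  s sys eM bal (fun u v => inord (index v (nbrs u))) _
  (fun u v => nth [::] css (ix u v))).
- move=> u v v' uv uv' /(congr1 val); rewrite /= !inordK ?lt3 //.
  move/(congr1 (nth u (nbrs u))).
  by rewrite !nth_index ?mem_enum ?inE.
- by move=> u v; rewrite ixC.
- by move=> u v uv; apply: good; apply: ltix.
- by move=> u v uv; rewrite chainE // uniq_nth_flatten.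
- move=> u v i uv; rewrite chainE // => /mem_nth_flatten/sub_css.
  by rewrite inE => /andP[].
- move=> u v u' v' i uv uv' ne; rewrite !chainE // => i1; apply/negP=> i2.
  case/eqP: ne; have := nth_flatten_inj ucss i1 i2.
  move/(congr1 (nth [set u; v] (enum (edges H)))).
  by rewrite !nth_index ?edgeP.
Qed.
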